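(* The class of $\mathfrak{Z}_{mon}$-cofinite groups is stable under taking subgroups and quotients with respect to finite normal subgroups. That is, if $G$ is a $\mathfrak{Z}_{mon}$-cofinite group, then every subgroup of $G$ is $\mathfrak{Z}_{mon}$-cofinite, and for every finite normal subgroup $N$ of $G$ the quotient group $G/N$ is $\mathfrak{Z}_{mon}$-cofinite.
   Context: For a group $G$ with neutral element $e$, the monomial topology $\mathfrak{Z}_{mon,G}$ is the topology on $G$ having as a subbase of its closed sets the family of all sets $\{x\in G : g x^n = e\}$ with $g\in G$, $n\in\mathbb{N}$. The group $G$ is called $\mathfrak{Z}_{mon}$-cofinite if $\mathfrak{Z}_{mon,G}$ is the cofinite topology on $G$ (closed sets: $G$ and the finite subsets of $G$). *)

(* Defs.v *)
From HB Require Import structures.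
From mathcomp Require Import all_boot all_classical.
From mathcomp Require Import topology.

Set Implicit Arguments.
Unset Strict Implicit.
Unset Printing Implicit Defensive.

Local Open Scope classical_set_scope.
Local Open Scope quotient_scope.
Local Open Scope group_scope.

(** * The monomial topology *)

(* For n = 0 the set below is setT or set0, which are closed in every topology,
   so the topology is the same whether or not 0 counts as a natural number. *)
Definition monomial_set (G : groupType) (g : G) (n : nat) : set G :=
  [set x | g * x ^+ n = 1].

(* G with its monomial topology; a copy of G, so that it does not clash with
   another topology on G. *)
Definition zmon (G : groupType) : Type := G.

HB.instance Definition _ (G : groupType) := Group.on (zmon G).

(* isSubBaseTopological takes a subbase of open sets, hence the complements. *)
HB.instance Definition _ (G : groupType) :=
  isSubBaseTopological.Build (zmon G)
    [set U : set G | exists g n, U = ~` monomial_set g n] id.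

Definition zmon_cofinite (G : groupType) : Prop :=
  forall F : set (zmon G), closed F <-> F = setT \/ finite_set F.

(** * Subgroups *)

Section Subgroup.
Variables (G : groupType) (H : groupClosed G).

Definition subgroup : Type := {x : G | x \in H}.

HB.instance Definition _ := SubChoice.on subgroup.

Fact subgroup_closed : group_closed H.
Proof. by split; [exact: gpred1 | exact: gpredF]. Qed.

HB.instance Definition _ :=
  SubChoice_isSubGroup.Build G (fun x => x \in H) subgroup subgroup_closed.

End Subgroup.

(** * Normal subgroups and quotient groups *)

HB.mixin Record isConjClosed (G : groupType) (N : {pred G}) := {
  gpred_conj : forall x y : G, x \in N -> x ^ y \in N
}.

#[short(type="normalClosed")]
HB.structure Definition NormalClosed (G : groupType) :=
  {N of GroupClosed G N & isConjClosed G N}.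

Section Quotient.
Variables (G : groupType) (N : normalClosed G).

Definition coset_equiv (x y : G) : bool := x^-1 * y \in N.

Lemma coset_equiv_is_equiv : equiv_class_of coset_equiv.
Proof.
split=> [x|x y|y x z]; rewrite /coset_equiv.
- by rewrite mulVg gpred1.
- by rewrite -(gpredV N) invgM invgK.
- by move=> xy yz; rewrite -[z](mulVKg y) mulgA gpredM.
Qed.

Canonical coset_equiv_equiv := EquivRelPack coset_equiv_is_equiv.
Canonical coset_equiv_encModRel := defaultEncModRel coset_equiv.

Definition quotg : Type := {eq_quot coset_equiv}.

HB.instance Definition _ : EqQuotient G coset_equiv quotg :=
  EqQuotient.on quotg.
HB.instance Definition _ := Choice.on quotg.

Definition quotg_one : quotg := \pi_quotg 1.
Definition quotg_inv (a : quotg) : quotg := \pi_quotg (repr a)^-1.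
Definition quotg_mul (a b : quotg) : quotg := \pi_quotg (repr a * repr b).

Lemma quotgP (x y : G) : reflect (x = y %[mod quotg]) (x^-1 * y \in N).
Proof. exact: (@eqmodP _ coset_equiv_equiv). Qed.

Lemma quotg_piV (x : G) : quotg_inv (\pi x) = \pi_quotg x^-1.
Proof.
apply/quotgP; set y := repr _.
have: y = x %[mod quotg] by rewrite reprK.
move/quotgP=> /(gpred_conj _ y^-1); rewrite /conjg !invgK.
rewrite mulgA mulVKg => yx.
by rewrite -(gpredV N) invgM invgK.
Qed.

Lemma quotg_piM (x y : G) :
  quotg_mul (\pi x) (\pi y) = \pi_quotg (x * y).
Proof.
apply/quotgP; set x' := repr (_ x); set y' := repr (_ y).
have /quotgP xx : x' = x %[mod quotg] by rewrite reprK.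
have /quotgP yy : y' = y %[mod quotg] by rewrite reprK.
have -> : (x' * y')^-1 * (x * y) = (x'^-1 * x) ^ y' * (y'^-1 * y).
  by rewrite /conjg invgM !mulgA mulgK.
by rewrite gpredM// gpred_conj.
Qed.

Lemma quotg_mulA : associative quotg_mul.
Proof.
by move=> a b c; rewrite -[a]reprK -[b]reprK -[c]reprK !quotg_piM mulgA.
Qed.

Lemma quotg_mul1 : left_id quotg_one quotg_mul.
Proof. by move=> a; rewrite -[a]reprK quotg_piM mul1g. Qed.

Lemma quotg_mulr1 : right_id quotg_one quotg_mul.
Proof. by move=> a; rewrite -[a]reprK quotg_piM mulg1. Qed.

Lemma quotg_mulV : left_inverse quotg_one quotg_inv quotg_mul.
Proof. by move=> a; rewrite -[a]reprK quotg_piV quotg_piM mulVg. Qed.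

Lemma quotg_mulrV : right_inverse quotg_one quotg_inv quotg_mul.
Proof. by move=> a; rewrite -[a]reprK quotg_piV quotg_piM mulgV. Qed.

HB.instance Definition _ :=
  isGroup.Build quotg quotg_mulA quotg_mul1 quotg_mulr1 quotg_mulV quotg_mulrV.

End Quotient.

(* Main.v *)
Require Import Defs.
From HB Require Import structures.
From mathcomp Require Import all_boot all_classical.
From mathcomp Require Import finmap topology.

(** The monomial topology is always T1, so it is cofinite exactly when each
    monomial set [{x | g x^n = 1}] is the whole group or finite
    ([zmon_cofiniteP]). This condition on equations passes to both
    constructions.

    For a subgroup [H] and [g] in [H], the monomial set of [H] is the trace on
    [H] of the one of [G], so it is again everything or finite.

    In [G/N], the equation [g x^n = 1] says that [g x^n] lies in [N] for a
    representative [x]; hence its solution set is the image of the union over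
    [m] in [N] of the solution sets of [m^-1 g x^n = 1] in [G]
    ([quotg_monomial_set]). If one of these is [G], the image is [G/N];
    otherwise it is the image of a finite union of finite sets. *)

Local Open Scope classical_set_scope.
Local Open Scope quotient_scope.
Local Open Scope group_scope.

Lemma monomial_set_closed (G : groupType) (g : G) (n : nat) :
  closed (monomial_set g n : set (zmon G)).
Proof.
rewrite -openC.
exists [set ~` monomial_set g n]; last by rewrite bigcup_set1.
by move=> _ ->; apply: finI_from1; exists g, n.
Qed.

(** The case n = 1 of the monomial equation has a single solution. *)
Lemma zmon_closed1 (G : groupType) (x : G) : closed ([set x] : set (zmon G)).
Proof.
suff -> : [set x] = monomial_set x^-1 1 by exact: monomial_set_closed.
apply/seteqP; split=> y /=; rewrite /monomial_set /= expg1.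
  by move=> ->; rewrite mulVg.
by move=> /(congr1 (fun z => x * z)); rewrite mulVKg mulg1.
Qed.

Lemma zmon_finite_closed (G : groupType) (F : set (zmon G)) :
  finite_set F -> closed F.
Proof.
move=> Ffin; have -> : F = \bigcup_(x in F) [set x].
  by apply/seteqP; split=> [x Fx|x [_ Fy ->]//]; exists x.
by apply: closed_bigcup => // x _; exact: zmon_closed1.
Qed.

(** The closed-set form of the fact that finite intersections of subbasic open
    sets are a base: around a point outside F there is a basic open set missing
    F, and its complement is a finite union of monomial sets. That every member
    of the cover avoids x is what excludes the whole group in
    [zmon_cofiniteP]. *)
Lemma zmon_closed_cover (G : groupType) (F : set (zmon G)) (x : G) :
  closed F -> ~ F x ->
  exists D : set (set G), [/\ finite_set D,
    forall V, D V -> ~ V x /\ exists g n, V = monomial_set g n &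
    F `<=` \bigcup_(V in D) V].
Proof.
pose subbase := [set U : set G | exists g n, U = ~` monomial_set g n].
move=> /closed_openC Fop Fx.
have [B sB eqB] : exists2 B : set (set G),
    B `<=` finI_from subbase id & \bigcup_(U in B) U = ~` F by exact: Fop.
have : (~` F) x by [].
rewrite -eqB => -[U BU Ux].
have [D sD eqU] := sB U BU.
exists (setC @` [set` D]); split.
- exact/finite_image/finite_fset.
- move=> _ [V DV <-]; split.
    by move: Ux; rewrite -eqU => /(_ V DV) Vx; apply.
  have /set_mem[g [n ->]] := sD V DV.
  by exists g, n; rewrite setCK.
- move=> y Fy; apply: contrapT => yD.
  suff : (~` F) y by [].
  rewrite -eqB; exists U => //; rewrite -eqU => V DV.
  by apply: contrapT => Vy; apply: yD; exists (~` V) => //; exists V.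
Qed.

(** Monomial sets are closed, which gives one direction. Conversely, a closed
    set that misses some x is covered by finitely many monomial sets missing x;
    none of these is the whole group, so all are finite. *)
Lemma zmon_cofiniteP (G : groupType) :
  zmon_cofinite G <->
  forall (g : G) n, monomial_set g n = setT \/ finite_set (monomial_set g n).
Proof.
split=> [hG g n|hG F].
  exact: (hG (monomial_set g n)).1 (monomial_set_closed G g n).
split=> [Fcl|[->|]]; last 2 first.
- exact: closedT.
- exact: zmon_finite_closed.
have [->|/eqP/setTPn[x Fx]] := pselect (F = setT); first by left.
right; have [D [Dfin Dmon FD]] := zmon_closed_cover G F x Fcl Fx.
apply: sub_finite_set FD _; apply: bigcup_finite => // V /Dmon[Vx [g [n eqV]]].
by have [gT|] := hG g n; [case: Vx; rewrite eqV gT | rewrite eqV].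
Qed.

Lemma zmon_cofinite_subgroup (G : groupType) (H : groupClosed G) :
  zmon_cofinite G -> zmon_cofinite (subgroup H).
Proof.
move=> /zmon_cofiniteP hG; apply/zmon_cofiniteP => g n.
have -> : monomial_set g n = val @^-1` monomial_set (val g) n.
  apply/seteqP; split=> x; rewrite /monomial_set /=.
    by move=> /(congr1 val); rewrite gmulfM gmulfXn gmulf1.
  by move=> e; apply: val_inj; rewrite gmulfM gmulfXn gmulf1.
have [->|fin] := hG (val g) n; first by left; rewrite preimage_setT.
by right; apply: finite_preimage fin => x y _ _; exact: val_inj.
Qed.

(** It suffices to solve the equation in G modulo N: the coset of x is a
    solution when m = g x^n belongs to N, that is, when x solves
    m^-1 g x^n = 1. *)
Lemma quotg_monomial_set (G : groupType) (N : normalClosed G) (g : G) n :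
  monomial_set (\pi_(quotg N) g) n =
  \pi_(quotg N) @` \bigcup_(m in [set m | m \in N]) monomial_set (m^-1 * g) n.
Proof.
have piX (x : G) : (\pi_(quotg N) x) ^+ n = \pi_(quotg N) (x ^+ n).
  elim: n => [//|k IH]; rewrite !expgS IH; exact: quotg_piM.
have mem x : monomial_set (\pi_(quotg N) g) n (\pi_(quotg N) x) <->
    g * x ^+ n \in N.
  rewrite /monomial_set /= piX.
  have -> : \pi_(quotg N) g * \pi_(quotg N) (x ^+ n) =
      \pi_(quotg N) (g * x ^+ n) by exact: quotg_piM.
  rewrite -(gpredV N) -[_^-1]mulg1.
  by split=> [/quotgP//|/quotgP].
apply/seteqP; split=> [a|_ [x [m Nm mx] <-]].
  rewrite -[a]reprK => /mem Na; exists (repr a) => //.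
  by exists (g * repr a ^+ n) => //=; rewrite /monomial_set /= -mulgA mulVg.
apply/mem; move: mx; rewrite /monomial_set /= -mulgA.
by move=> /(congr1 (fun z => m * z)); rewrite mulVKg mulg1 => ->.
Qed.

Lemma zmon_cofinite_quotg (G : groupType) (N : normalClosed G) :
  finite_set [set x : G | x \in N] -> zmon_cofinite G ->
  zmon_cofinite (quotg N).
Proof.
move=> Nfin /zmon_cofiniteP hG; apply/zmon_cofiniteP => a n.
rewrite -[a]reprK quotg_monomial_set; set g := repr a.
have [[m Nm mT]|noT] :=
  pselect (exists2 m, m \in N & monomial_set (m^-1 * g) n = setT).
  left; apply/seteqP; split=> // b _; exists (repr b); last exact: reprK.
  by exists m => //; rewrite mT.
right; apply/finite_image/bigcup_finite => // m Nm.
by have [mT|//] := hG (m^-1 * g) n; case: noT; exists m.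
Qed.

Theorem corollary4p8 (G : groupType) (hG : zmon_cofinite G) :
  (forall H : groupClosed G, zmon_cofinite (subgroup H)) /\
  (forall N : normalClosed G,
     finite_set [set x : G | x \in N] -> zmon_cofinite (quotg N)).
Proof.
split=> [H|N Nfin]; first exact: zmon_cofinite_subgroup.
exact: zmon_cofinite_quotg.
Qed.
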